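(* For every non-negative integer $m$, \[ R_E(m)=\frac{2(2^{2m+2}-1)B_{2m+2}}{m+1}. \]
   Context: $B_s$ is the $s$th Bernoulli number (e.g. $B_2=1/6$, $B_4=-1/30$). The function $R_E$ on non-negative integers is defined by $R_E(0)=1$ and, for $m\geq 1$, by \[ R_E(m)=\sum_{j=1}^m(-1)^j\frac{(2j)!}{2^{2j}}M(m,j) =(2m)!\sum_{j=1}^m\left(-\frac12\right)^j\sum_{(i_1,\dots,i_j)\in E_{m,j}}\frac{1}{(2i_1)!(2i_2)!\cdots(2i_j)!} \] \[ =\sum_{j=1}^m\left(-\frac12\right)^j\sum_{(I_1,\dots,I_j)\in\tilde{E}_{m,j}}\binom{2I_2}{2I_1}\binom{2I_3}{2I_2}\cdots\binom{2I_j}{2I_{j-1}}, \] where these expressions agree, and $E_{m,j}=\{(i_1,\dots,i_j)\in\mathbb{Z}^j : i_1>0,\dots,i_j>0,\ i_1+\cdots+i_j=m\}$, $\tilde{E}_{m,j}=\{(I_1,\dots,I_j)\in\mathbb{Z}^j : 0<I_1<I_2<\cdots<I_j=m\}$; the product of binomial coefficients is interpreted as $1$ when $j=1$. Here $M(m,j)$ is the central factorial number of the second kind, defined for positive integers $m,j$ by $(e^z+e^{-z}-2)^j=\sum_{m=1}^{\infty}\frac{(2j)!}{(2m)!}M(m,j)z^{2m}$. *)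

(* Defs.v *)
From HB Require Import structures.
From mathcomp Require Import all_boot all_order all_algebra.
From mathcomp Require Import ring zify.
Set Implicit Arguments.
Unset Strict Implicit.
Unset Printing Implicit Defensive.
Import Order.TTheory GRing.Theory Num.Theory.
Local Open Scope ring_scope.

(* A formal power series \sum_n a_n z^n over the rationals is represented by
   its coefficient function a : nat -> rat. *)
Definition fps_mul (a b : nat -> rat) (n : nat) : rat :=
  \sum_(i < n.+1) a i * b (n - i)%N.

Fixpoint fps_pow (a : nat -> rat) (j : nat) : nat -> rat :=
  if j is j'.+1 then fps_mul a (fps_pow a j') else fun n => (n == 0%N)%:R.

(* e^z + e^(-z) - 2 *)
Definition central_gf (n : nat) : rat :=
  (n`!)%:R^-1 + (-1) ^+ n * (n`!)%:R^-1 - 2%:R * (n == 0%N)%:R.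

(* Central factorial number of the second kind M(m, j); only meaningful for
   m, j > 0.  See central_factorial_gf for the generating function. *)
Definition central_factorial (m j : nat) : rat :=
  ((2 * m)`!)%:R / ((2 * j)`!)%:R * fps_pow central_gf j (2 * m)%N.

(* The sequence [:: B_0; ...; B_(n-1)]. *)
Fixpoint bernoulli_seq (n : nat) : seq rat :=
  if n is n'.+1 then
    let s := bernoulli_seq n' in
    rcons s ((n' == 0%N)%:R -
             (n'.+1)%:R^-1 * \sum_(k < n') ('C(n'.+1, k))%:R * s`_k)
  else [::].

Definition bernoulli (n : nat) : rat := (bernoulli_seq n.+1)`_n.

(* The alternative expressions for RE m are RE_compositions and RE_chains. *)
Definition RE (m : nat) : rat :=
  if m is 0%N then 1 else
  \sum_(1 <= j < m.+1)
    (-1) ^+ j * (((2 * j)`!)%:R / 2%:R ^+ (2 * j)) * central_factorial m j.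

Lemma factr_neq0 n : (n`!)%:R != 0 :> rat.
Proof. by rewrite pnatr_eq0 -lt0n fact_gt0. Qed.

Lemma binr_fact (n k : nat) : (k <= n)%N ->
  ('C(n, k))%:R = (n`!)%:R / ((k`!)%:R * ((n - k)`!)%:R) :> rat.
Proof.
move=> lekn; rewrite -(bin_fact lekn) !natrM mulfK //.
by rewrite mulf_neq0 // factr_neq0.
Qed.

Lemma central_gfE n :
  central_gf n = if odd n || (n == 0%N) then 0 else 2%:R / (n`!)%:R.
Proof.
rewrite /central_gf; case: (eqVneq n 0%N) => [->|n0] /=.
  by rewrite fact0; field.
by rewrite orbF -signr_odd; case: odd; rewrite /= ?expr0 ?expr1; ring.
Qed.

Lemma fps_pow_gf_odd j n : odd n -> fps_pow central_gf j n = 0.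
Proof.
elim: j n => [|j IH] n on /=; first by case: n on.
rewrite /fps_mul big1 // => i _; rewrite central_gfE.
case: ifP => [|/norP[ei _]]; rewrite ?mul0r // IH ?mulr0 // oddB ?on ?(negbTE ei) //.
by rewrite -ltnS.
Qed.

Lemma central_factorial_gf (j n : nat) : (0 < j)%N ->
  fps_pow central_gf j n =
  if odd n || (n == 0%N) then 0
  else ((2 * j)`!)%:R / (n`!)%:R * central_factorial n./2 j.
Proof.
move=> j0; case: ifP => [/orP[on|/eqP->]|/norP[en _]].
- exact: fps_pow_gf_odd.
- by case: j j0 => // j _; rewrite /= /fps_mul big_ord1 central_gfE mul0r.
- rewrite /central_factorial.
  have -> : (2 * n./2 = n)%N by rewrite mul2n even_halfK.
  by field; rewrite !factr_neq0.
Qed.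

Lemma size_bernoulli_seq n : size (bernoulli_seq n) = n.
Proof. by elim: n => //= n IH; rewrite size_rcons IH. Qed.

Lemma nth_bernoulli_seq n k : (k < n)%N -> (bernoulli_seq n)`_k = bernoulli k.
Proof.
elim: n => // n IH; rewrite ltnS leq_eqVlt => /orP[/eqP->//|kn].
by rewrite /= nth_rcons size_bernoulli_seq kn IH.
Qed.

Lemma bernoulli_rec n :
  \sum_(k < n.+1) ('C(n.+1, k))%:R * bernoulli k = (n == 0%N)%:R :> rat.
Proof.
rewrite big_ord_recr /= {2}/bernoulli /= nth_rcons size_bernoulli_seq ltnn eqxx.
rewrite (eq_bigr (fun k : 'I_n => ('C(n.+1, k))%:R * (bernoulli_seq n)`_k)); last first.
  by move=> k _; rewrite nth_bernoulli_seq.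
rewrite binSn; have n0 : (n.+1)%:R != 0 :> rat by rewrite pnatr_eq0.
rewrite mulrBr mulVKf // addrC subrK.
by case: n {n0} => [|n]; rewrite ?mul1r ?mulr0.
Qed.

(* (\sum_n B_n z^n / n!) (e^z - 1) = z *)
Lemma bernoulli_gf n :
  fps_mul (fun k => bernoulli k / (k`!)%:R)
          (fun k => (k`!)%:R^-1 - (k == 0%N)%:R) n = (n == 1%N)%:R.
Proof.
rewrite /fps_mul big_ord_recr /= subnn fact0 invr1 subrr mulr0 addr0.
case: n => [|n]; first by rewrite big_ord0.
have -> : (n.+1 == 1%N)%:R = (((n.+1)`!)%:R)^-1 * (n == 0%N)%:R :> rat.
  by case: n => [|n]; rewrite ?mulr0 // mulr1 invr1.
rewrite -bernoulli_rec big_distrr /=; apply: eq_bigr => k _.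
have kn : (k <= n.+1)%N := ltnW (ltn_ord k).
have -> : (n.+1 - k == 0)%N = false by rewrite subn_eq0 leqNgt ltn_ord.
by rewrite binr_fact // subr0; field; rewrite !factr_neq0.
Qed.

Definition comp_sum (N m j : nat) : rat :=
  \sum_(t : j.-tuple 'I_N | all (ltn 0) (map val t) && (sumn (map val t) == m))
    \prod_(i <- t) ((2 * i)`!)%:R^-1.

Definition chain_sum (N a m j : nat) : rat :=
  \sum_(t : j.-tuple 'I_N | path ltn a (map val t) && (last a (map val t) == m))
    \prod_(c <- pairmap (fun x y => 'C(2 * y, 2 * x)) a (map val t)) c%:R.

Lemma big_tupleS (T : finType) j (P : pred (seq T)) (F : seq T -> rat) :
  \sum_(t : j.+1.-tuple T | P t) F t =
  \sum_(x : T) \sum_(t : j.-tuple T | P (x :: t)) F (x :: t).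
Proof.
rewrite pair_big_dep /=.
rewrite (reindex (fun p : T * j.-tuple T => [tuple of p.1 :: p.2])) /=.
  by apply: eq_bigl => -[].
exists (fun t : j.+1.-tuple T => (thead t, [tuple of behead t])) => [[x t]|t] _ /=.
  by rewrite theadE; congr pair; apply: val_inj.
by rewrite [RHS]tuple_eta.
Qed.

Lemma big_tuple0 (T : finType) (P : pred (seq T)) (F : seq T -> rat) :
  \sum_(t : 0.-tuple T | P t) F t = if P [::] then F [::] else 0.
Proof.
rewrite big_mkcond (big_pred1 [tuple]) //= => t.
by rewrite /= (tuple0 t); apply/esym/eqP.
Qed.

Definition comps (j m : nat) : rat := fps_pow central_gf j (2 * m)%N / 2%:R ^+ j.

Lemma compsS j m :
  comps j.+1 m = \sum_(i < m.+1 | (0 < i)%N) ((2 * i)`!)%:R^-1 * comps j (m - i)%N.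
Proof.
rewrite /comps /= /fps_mul.
rewrite -(big_mkord xpredT (fun i => central_gf i * fps_pow central_gf j (2 * m - i)%N)).
have H k : \sum_(0 <= i < (2 * k).+1) central_gf i * fps_pow central_gf j (2 * m - i)%N
   = \sum_(i < k.+1) central_gf (2 * i)%N * fps_pow central_gf j (2 * m - 2 * i)%N.
  elim: k => [|k IH]; first by rewrite muln0 big_nat1 big_ord1 muln0.
  have -> : ((2 * k.+1).+1 = (2 * k).+3)%N by rewrite mulnS.
  rewrite [LHS]big_nat_recr // big_nat_recr //= IH [RHS]big_ord_recr /= !mulnS !add2n.
  by rewrite [central_gf (2 * k).+1]central_gfE /= oddM /= mul0r addr0.
rewrite H [in RHS]big_mkcond mulr_suml; apply: eq_bigr => i _.
rewrite central_gfE oddM /= muln_eq0 /= lt0n mulnBr.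
case: eqVneq => _; first by rewrite !mul0r.
by rewrite exprS; field; rewrite factr_neq0 expf_neq0.
Qed.

Lemma comp_sumE N m j : (m < N)%N -> comp_sum N m j = comps j m.
Proof.
elim: j m => [|j IH] m mN.
  rewrite /comp_sum (big_tuple0 (fun t => all (ltn 0) (map val t) && (sumn (map val t) == m))
     (fun t : seq 'I_N => \prod_(i <- t) ((2 * i)`!)%:R^-1)).
  by rewrite /= big_nil /comps /= expr0 divr1 eq_sym muln_eq0; case: eqVneq.
rewrite /comp_sum (@big_tupleS _ _ (fun t => all (ltn 0) (map val t) && (sumn (map val t) == m))
     (fun t : seq 'I_N => \prod_(i <- t) ((2 * i)`!)%:R^-1)) /= compsS.
rewrite (big_ord_widen_cond N (fun i => (0 < i)%N) 
  (fun i => ((2 * i)`!)%:R^-1 * comps j (m - i)%N)) // big_mkcond /= [RHS]big_mkcond /=.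
apply: eq_bigr => x _; rewrite ltnS; case: (ltnP 0 x) => x0 /=; last first.
  by rewrite big_pred0.
case: (leqP x m) => xm; last first.
  by rewrite big_pred0 // => t; rewrite eqn_leq leqNgt ltn_addr // andbF.
rewrite -IH ?(leq_ltn_trans (leq_subr _ _)) // /comp_sum big_distrr /=.
apply: eq_big => [t|t _]; last by rewrite big_cons.
by rewrite -{1}(subnKC xm) eqn_add2l.
Qed.

Lemma chain_sumE N a m j : (m < N)%N -> (a <= m)%N ->
  chain_sum N a m j = ((2 * m)`!)%:R / ((2 * a)`!)%:R * comps j (m - a)%N.
Proof.
elim: j a => [|j IH] a mN am.
  rewrite /chain_sum (big_tuple0
     (fun t => path ltn a (map val t) && (last a (map val t) == m))
     (fun t : seq 'I_N =>
       \prod_(c <- pairmap (fun x y => 'C(2 * y, 2 * x)) a (map val t)) c%:R)).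
  rewrite /= big_nil /comps /= expr0 divr1 muln_eq0 /= subn_eq0.
  rewrite [(a == m)]eqn_leq am /=.
  case: leqP => ma; last by rewrite mulr0.
  by rewrite (@anti_leq m a) ?ma ?am // mulr1 divff ?factr_neq0.
rewrite /chain_sum (@big_tupleS _ _
     (fun t => path ltn a (map val t) && (last a (map val t) == m))
     (fun t : seq 'I_N =>
       \prod_(c <- pairmap (fun x y => 'C(2 * y, 2 * x)) a (map val t)) c%:R)) /=.
rewrite compsS big_distrr /=.
have -> : \sum_(i < (m - a).+1 | (0 < i)%N) ((2 * m)`!)%:R / ((2 * a)`!)%:R *
      (((2 * i)`!)%:R^-1 * comps j (m - a - i)%N) =
   \sum_(x < N | (a < x <= m)%N) ((2 * m)`!)%:R / ((2 * a)`!)%:R *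
      (((2 * (x - a))`!)%:R^-1 * comps j (m - x)%N).
  rewrite -(big_mkord (fun i => 0 < i)%N (fun i => ((2 * m)`!)%:R / ((2 * a)`!)%:R *
      (((2 * i)`!)%:R^-1 * comps j (m - a - i)%N))).
  rewrite -(big_mkord (fun x => a < x <= m)%N (fun x => ((2 * m)`!)%:R / ((2 * a)`!)%:R *
      (((2 * (x - a))`!)%:R^-1 * comps j (m - x)%N))).
  rewrite [RHS](@big_cat_nat _ _ _ a 0%N) //=; last exact: leq_trans am (ltnW mN).
  rewrite [X in _ = X + _]big1_seq => [|i]; last first.
    by rewrite mem_index_iota => /andP[/andP[ai _] /andP[_]]; rewrite ltnNge ltnW.
  rewrite add0r [RHS](@big_cat_nat _ _ _ m.+1 a) //=; last exact: leqW.
  rewrite [X in _ = _ + X]big1_seq => [|i]; last first.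
    by rewrite mem_index_iota => /andP[/andP[_ im] /andP[]]; rewrite ltnNge im.
  rewrite addr0 (_ : index_iota a m.+1 = index_iota (0 + a) m.+1) // big_addn subSn // big_mkcond [RHS]big_mkcond.
  apply: eq_big_nat => i /andP[_ im].
  have -> : (a < i + a <= m)%N = (0 < i)%N by lia.
  have -> : (m - (i + a) = m - a - i)%N by lia.
  by rewrite addnK.
rewrite [RHS]big_mkcond /=; apply: eq_bigr => x _.
case: (ltnP a x) => ax /=; last by rewrite big_pred0.
case: (leqP x m) => xm; last first.
  rewrite big_pred0 // => t; apply/negP => /andP[px /eqP lx].
  have : all (leq x) (val x :: map val t).
    apply: (order_path_min leq_trans).
    rewrite /= leqnn /=; apply: sub_path px => u v; exact: ltnW.
  by move=> /allP /(_ _ (mem_last _ _)); rewrite lx leqNgt xm.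
transitivity (('C(2 * x, 2 * a))%:R * chain_sum N x m j).
  by rewrite /chain_sum big_distrr /=; apply: eq_bigr => t _; rewrite big_cons.
rewrite IH // binr_fact ?leq_mul2l ?(ltnW ax) ?orbT // -mulnBr.
by field; rewrite !factr_neq0.
Qed.

Lemma chain_prod j (t : seq nat) : size t = j ->
  \prod_(c <- pairmap (fun x y => 'C(2 * y, 2 * x)) 0%N t) c%:R =
  \prod_(1 <= k < j) ('C(2 * nth 0%N t k, 2 * nth 0%N t k.-1))%:R :> rat.
Proof.
move=> <-; rewrite (big_nth 0%N) size_pairmap.
case: t => [|x t]; first by rewrite !big_geq.
rewrite big_ltn //= bin0 mul1r; apply: eq_big_nat => i /andP[i1 it].
by rewrite -[pairmap _ x t]/(behead (pairmap _ 0%N (x :: t))); case: i i1 it => // i _ it;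
   rewrite /= (nth_pairmap 0%N).
Qed.

(* The second expression for R_E: t runs over the compositions
   (i_1, ..., i_j) of m into j positive parts, i.e. over E_{m,j}. *)
Lemma RE_compositions (m : nat) : (0 < m)%N ->
  RE m = ((2 * m)`!)%:R * \sum_(1 <= j < m.+1) (- 2%:R^-1) ^+ j *
    \sum_(t : j.-tuple 'I_m.+1 |
           all (ltn 0) (map val t) && (sumn (map val t) == m))
      \prod_(i <- t) ((2 * i)`!)%:R^-1.
Proof.
case: m => // m _; rewrite /RE big_distrr /=; apply: eq_bigr => j _.
have := @comp_sumE m.+2 m.+1 j (leqnn _); rewrite /comp_sum => ->.
rewrite /central_factorial /comps [(- 2%:R^-1) ^+ j]exprNn exprVn.
have -> : 2%:R ^+ (2 * j) = 2%:R ^+ j * 2%:R ^+ j :> rat.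
  by rewrite mul2n -addnn exprD.
by field; rewrite factr_neq0 expf_neq0.
Qed.

(* The third expression for R_E: t runs over the chains
   0 < I_1 < ... < I_j = m. *)
Lemma RE_chains (m : nat) : (0 < m)%N ->
  RE m = \sum_(1 <= j < m.+1) (- 2%:R^-1) ^+ j *
    \sum_(t : j.-tuple 'I_m.+1 |
           path ltn 0 (map val t) && (last 0%N (map val t) == m))
      \prod_(1 <= k < j)
        ('C(2 * nth 0%N (map val t) k, 2 * nth 0%N (map val t) k.-1))%:R.
Proof.
move=> m0; rewrite RE_compositions // big_distrr /=; apply: eq_bigr => j _.
have := @comp_sumE m.+1 m j (leqnn _); rewrite /comp_sum => ->.
have := @chain_sumE m.+1 0 m j (leqnn _) (leq0n _); rewrite /chain_sum.
rewrite (eq_bigr _ (fun t _ => chain_prod (etrans (size_map _ _) (size_tuple t)))).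
by move=> ->; rewrite muln0 fact0 divr1 subn0 mulrCA.
Qed.

(* Main.v *)
(* \sum_m R_E(m) z^(2m) / (2m)! is the geometric series
   1 / (1 + c/4) with c = e^z + e^(-z) - 2, that is 4 e^z / (e^z + 1)^2, the
   derivative of 4 h with h = - 1 / (e^z + 1).  On the other hand
   \sum_n (2^n - 1) B_n z^n / n! = 2z / (e^(2z) - 1) - z / (e^z - 1) = z h.
   Power series identities are expressed as congruences modulo 'X^N between
   truncations in {poly rat}. *)
Require Import Defs.
From mathcomp Require Import all_boot all_order all_algebra.
From mathcomp Require Import ring zify.
Set Implicit Arguments.
Unset Strict Implicit.
Unset Printing Implicit Defensive.
Import GRing.Theory Num.Theory.
Local Open Scope ring_scope.

(** * Congruences modulo ['X^N] and truncated series *)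

Lemma dvdXnP (F : fieldType) (N : nat) (p : {poly F}) :
  reflect (forall i, (i < N)%N -> p`_i = 0) ('X^N %| p).
Proof.
apply: (iffP idP) => [/dvdpP[q ->] i iN|p0]; first by rewrite coefMXn iN.
rewrite -(poly_take_drop N p) (_ : take_poly N p = 0) ?add0r ?dvdp_mulIr //.
by apply/polyP => i; rewrite coef_take_poly coef0; case: ifP => // /p0.
Qed.

Lemma dvdXn_deriv (F : fieldType) (N : nat) (p : {poly F}) :
  'X^(N.+1) %| p -> 'X^N %| p^`().
Proof.
by move=> /dvdXnP p0; apply/dvdXnP => i iN; rewrite coef_deriv p0 ?mul0rn.
Qed.

Definition trunc (N : nat) (f : nat -> rat) : {poly rat} := \poly_(i < N) f i.

Lemma trunc_mul N f g : 'X^N %| trunc N f * trunc N g - trunc N (fps_mul f g).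
Proof.
apply/dvdXnP => i iN; rewrite coefB coefM coef_poly iN /fps_mul.
apply/eqP; rewrite subr_eq0; apply/eqP/eq_bigr => j _.
by rewrite !coef_poly !ifT //; have := ltn_ord j; lia.
Qed.

Lemma trunc_pow N f j : 'X^N %| trunc N f ^+ j - trunc N (fps_pow f j).
Proof.
elim: j => [|j IH].
  by apply/dvdXnP => i iN; rewrite coefB coef_poly iN expr0 coef1 subrr.
have -> : trunc N f ^+ j.+1 - trunc N (fps_pow f j.+1) =
    trunc N f * (trunc N f ^+ j - trunc N (fps_pow f j)) +
    (trunc N f * trunc N (fps_pow f j) - trunc N (fps_pow f j.+1)).
  by rewrite exprS; ring.
by rewrite dvdp_add ?dvdp_mull ?trunc_mul.
Qed.

(** * Exponential and Bernoulli series, and the series h *)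

Definition exp_coef (a : rat) (n : nat) : rat := a ^+ n / (n`!)%:R.

(** The coefficients of az / (e^(az) - 1). *)
Definition bernoulli_coef (a : rat) (n : nat) : rat :=
  a ^+ n * bernoulli n / (n`!)%:R.

Lemma exp_coefD a b n :
  fps_mul (exp_coef a) (exp_coef b) n = exp_coef (a + b) n.
Proof.
rewrite /fps_mul /exp_coef addrC exprDn mulr_suml; apply: eq_bigr => i _.
have le_in : (i <= n)%N by rewrite -ltnS.
by rewrite -[_ *+ 'C(_, _)]mulr_natr binr_fact //; field; rewrite !factr_neq0.
Qed.

Lemma trunc_expD N a b :
  'X^N %| trunc N (exp_coef a) * trunc N (exp_coef b) -
          trunc N (exp_coef (a + b)).
Proof.
have <- : trunc N (fps_mul (exp_coef a) (exp_coef b)) =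
    trunc N (exp_coef (a + b)).
  by apply: eq_poly => i _; exact: exp_coefD.
exact: trunc_mul.
Qed.

Lemma trunc_exp0 N : 'X^N %| trunc N (exp_coef 0) - 1.
Proof.
apply/dvdXnP => i iN; rewrite coefB coef_poly iN coef1 /exp_coef expr0n.
by case: i {iN} => [|i]; rewrite ?mul0r ?divr1 subrr.
Qed.

Lemma deriv_trunc_exp N :
  'X^N %| (trunc N.+1 (exp_coef 1))^`() - trunc N.+1 (exp_coef 1).
Proof.
apply/dvdXnP => i iN.
rewrite coefB coef_deriv !coef_poly ltnS iN ltnW // /exp_coef !expr1n factS natrM.
rewrite -[_ *+ i.+1]mulr_natr; field.
by rewrite factr_neq0 addrC natr1 pnatr_eq0.
Qed.

(** Substituting az for z in [bernoulli_gf] multiplies the coefficient of z^i by a^i. *)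
Lemma trunc_bernoulli N a :
  'X^N %| trunc N (bernoulli_coef a) * (trunc N (exp_coef a) - 1) - a *: 'X.
Proof.
apply/dvdXnP => i iN; rewrite coefB coefM coefZ coefX.
have -> : a * (i == 1%N)%:R = a ^+ i * (i == 1%N)%:R.
  by case: eqVneq => [->|]; rewrite ?expr1 ?mulr0.
rewrite -bernoulli_gf /fps_mul big_distrr -sumrB big1 // => j _ /=.
have ji : (j <= i)%N by rewrite -ltnS.
rewrite coefB !coef_poly coef1 !ifT; [|lia|lia].
rewrite /bernoulli_coef /exp_coef (_ : a ^+ i = a ^+ j * a ^+ (i - j)); last first.
  by rewrite -exprD subnKC.
have [->|_] := eqVneq (i - j)%N 0%N; rewrite ?fact0 ?expr0 /= ?mulr1n ?mulr0n.
  by field; rewrite factr_neq0.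
by field; rewrite !factr_neq0.
Qed.

(** The coefficients of h. The index shift divides z h by z, which is exact because the constant
    term (2^0 - 1) B_0 is zero. *)
Definition h_coef (n : nat) : rat :=
  (2%:R ^+ n.+1 - 1) * bernoulli n.+1 / (n.+1`!)%:R.

Lemma trunc_h N :
  'X^N %| trunc N.+1 h_coef * (trunc N.+2 (exp_coef 1) + 1) + 1.
Proof.
set H := trunc _ h_coef; set E := trunc _ _.
have B1 := trunc_bernoulli N.+2 1; have B2 := trunc_bernoulli N.+2 2%:R.
have E2 := trunc_expD N.+2 1 1.
rewrite -/E in B1 E2; rewrite -[1 + 1]/(2%:R : rat) in E2.
have : 'X * H = trunc N.+2 (bernoulli_coef 2%:R) - trunc N.+2 (bernoulli_coef 1).
  apply/polyP => -[|i]; rewrite coefXM coefB !coef_poly /bernoulli_coef /h_coef.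
    by rewrite /= !expr0 subrr.
  by rewrite !ltnS /=; case: ifP => _; rewrite ?subrr // expr1n; ring.
move: B1 B2 E2; set b := trunc _ (bernoulli_coef 1).
set b2 := trunc _ (bernoulli_coef _); set e2 := trunc _ (exp_coef 2%:R).
rewrite scale1r scaler_nat => B1 B2 E2 XH.
(* Since ['X * H] is [b2 - b] and (E + 1)(E - 1) is congruent to [e2 - 1], the product reduces to 2z
   - (E + 1) z + (E - 1) z = 0. *)
have D : 'X^(N.+2) %| 'X * (H * (E + 1) + 1) * (E - 1).
  have -> : 'X * (H * (E + 1) + 1) * (E - 1) =
     (b2 * (e2 - 1) - 'X *+ 2) + b2 * (E * E - e2) -
     (E + 1) * (b * (E - 1) - 'X).
    transitivity ('X * H * (E + 1) * (E - 1) + 'X * (E - 1)); first by ring.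
    by rewrite XH; ring.
  exact: dvdp_sub (dvdp_add B2 (dvdp_mull _ E2)) (dvdp_mull _ B1).
(* [E - 1] has no constant term and cannot be inverted. Multiplying by [b] turns it into z instead;
   cancelling z^2 then costs the two extra orders of precision. *)
rewrite -(@dvdp_mul2l _ 'X^2) ?expf_neq0 ?polyX_eq0 // -exprD add2n.
have -> : 'X^2 * (H * (E + 1) + 1) = b * ('X * (H * (E + 1) + 1) * (E - 1))
   - 'X * (H * (E + 1) + 1) * (b * (E - 1) - 'X) by ring.
exact: dvdp_sub (dvdp_mull _ D) (dvdp_mull _ B1).
Qed.

(** * The geometric series for R_E *)

Lemma central_gf_exp n : central_gf n =
  exp_coef 1 n + exp_coef (-1) n - 2%:R * (n == 0%N)%:R.
Proof. by rewrite /central_gf /exp_coef expr1n mul1r. Qed.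

Lemma trunc_central_gf N : 'X^N %| trunc N central_gf -
  (trunc N (exp_coef 1) + trunc N (exp_coef (-1)) - 2%:R).
Proof.
apply/dvdXnP => i iN.
rewrite !coefB coefD !coef_poly iN central_gf_exp -polyC_natr coefC.
by case: eqP => _ /=; ring.
Qed.

Lemma dvdX2_central_gf N : 'X^2 %| trunc N central_gf.
Proof.
apply/dvdXnP => i i2; rewrite coef_poly central_gfE.
by case: ifP => // _; case: i i2 => [|[|]].
Qed.

(** The factors (2j)! of [RE] and [central_factorial] cancel, and 2^(2j) = 4^j. The added term j = 0
    accounts for R_E(0) = 1 and vanishes when m > 0. *)
Lemma RE_geometric m : RE m / ((2 * m)`!)%:R =
  \sum_(j < m.+1) (- 4%:R^-1) ^+ j * fps_pow central_gf j (2 * m)%N.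
Proof.
case: m => [|m]; first by rewrite big_ord1 muln0 /= fact0 divr1.
rewrite big_ord_recl /= mulr0 add0r /RE big_add1 /= big_mkord mulr_suml.
apply: eq_bigr => j _; rewrite /central_factorial /bump add1n [(- 4%:R^-1) ^+ _]exprNn.
rewrite [2%:R ^+ _]exprM (_ : 2%:R ^+ 2 = 4%:R :> rat) // exprVn.
rewrite -[fps_mul _ _]/(fps_pow central_gf j.+1).
by field; rewrite !factr_neq0 expf_neq0.
Qed.

(** With x = - c/4 one has 4 + c = - 4 (x - 1), so the sum telescopes and leaves - 4 x^(m+1). This
    has order at least 2(m + 1), because z^2 divides c. *)
Lemma trunc_geometric N m (c := trunc N central_gf) :
  'X^(2 * m.+1) %| (\sum_(j < m.+1) (- 4%:R^-1) ^+ j *: c ^+ j) * (4%:R + c)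
                    - 4%:R.
Proof.
have -> : \sum_(j < m.+1) (- 4%:R^-1) ^+ j *: c ^+ j =
    \sum_(j < m.+1) (- 4%:R^-1 *: c) ^+ j.
  by apply: eq_bigr => j _; rewrite exprZn.
set x := - 4%:R^-1 *: c.
have -> : 4%:R + c = - 4%:R * (x - 1).
  rewrite /x -mulr_algl; have : 4%:R * (4%:R^-1)%:A = 1 :> {poly rat}.
    by rewrite mulr_algr -polyC_natr -mul_polyC -polyCM mulVf.
  by rewrite scaleNr => H4; ring: H4.
rewrite mulrCA [_ * (x - 1)]mulrC -subrX1.
have -> : - 4%:R * (x ^+ m.+1 - 1) - 4%:R = - 4%:R * x ^+ m.+1 by ring.
rewrite dvdp_mull // exprM dvdp_exp2r // /x.
by rewrite -mul_polyC dvdp_mull // dvdX2_central_gf.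
Qed.

(* With H, E, F, c, R truncating h, e^z, e^(-z), c, R_E, the derivative of
   H (E + 1) = - 1 gives H' (E + 1)^2 = E, hence H' (E + F + 2) = 1 by E F = 1;
   as 4 + c = E + F + 2 and R (4 + c) = 4, this yields R = 4 H'. *)
Lemma RE_coef m :
  RE m / ((2 * m)`!)%:R = 4%:R * ((2 * m).+1)%:R * h_coef (2 * m).+1.
Proof.
(* Modulus ['X^M] just reaches the coefficient of z^(2m). Differentiating costs one order, so
   [trunc_h] is used at [M.+1], where its exponential is truncated at [M.+3]. *)
set M := (2 * m).+1; pose N := M.+3; pose c := trunc N central_gf.
pose R := \sum_(j < m.+1) (- 4%:R^-1) ^+ j *: c ^+ j.
pose E := trunc N (exp_coef 1); pose F := trunc N (exp_coef (-1)).
pose H := trunc M.+2 h_coef.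
have weaken n (p : {poly rat}) : (M <= n)%N -> 'X^n %| p -> 'X^M %| p.
  by move=> Mn; apply: dvdp_trans; exact: dvdp_exp2l.
have hE : 'X^(M.+1) %| H * (E + 1) + 1 by exact: trunc_h.
have dhE : 'X^M %| H^`() * (E + 1) + H * E^`().
  by have := dvdXn_deriv hE; rewrite derivD derivM derivD derivC !addr0.
have {}hE : 'X^M %| H * (E + 1) + 1 by apply: weaken hE.
have dE : 'X^M %| E^`() - E by apply: weaken (deriv_trunc_exp _); lia.
have EF : 'X^M %| E * F - 1.
  have := dvdp_add (trunc_expD N 1 (-1)) (trunc_exp0 N).
  by rewrite addrN addrA subrK; apply: weaken; lia.
have cE : 'X^M %| c - (E + F - 2%:R).
  by apply: weaken (trunc_central_gf N); lia.
have Rc : 'X^M %| R * (4%:R + c) - 4%:R.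
  by apply: weaken (trunc_geometric N m); lia.
have {}dhE : 'X^M %| H^`() * (E + 1) + H * E.
  have := dvdp_sub dhE (dvdp_mull H dE).
  by congr (_ %| _); ring.
have {dE hE}dhE : 'X^M %| H^`() * (E + 1) ^+ 2 - E.
  have := dvdp_sub (dvdp_mull (E + 1) dhE) (dvdp_mull E hE).
  by congr (_ %| _); ring.
have {EF}dhE : 'X^M %| H^`() * (E + F + 2%:R) - 1.
  (* The second cofactor replaces each E F by 1 in F (H' (E + 1)^2 - E). *)
  have := dvdp_add (dvdp_mull F dhE) (dvdp_mull (1 - H^`() * (E + 2%:R)) EF).
  by congr (_ %| _); ring.
have /dvdXnP RH : 'X^M %| R - 4%:R * H^`().
  have := dvdp_sub (dvdp_sub (dvdp_mull H^`() Rc) (dvdp_mull (R * H^`()) cE))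
    (dvdp_mull R dhE).
  by congr (_ %| _); ring.
have {RH} /eqP := RH (2 * m)%N (ltnSn _).
rewrite coefB subr_eq0 -polyC_natr coefCM coef_deriv coef_poly ltnW // => /eqP RH.
rewrite -mulrA [_%:R * h_coef _]mulr_natl -RH RE_geometric coef_sum.
apply: eq_bigr => j _; rewrite coefZ; congr (_ * _); apply/esym/eqP; rewrite -subr_eq0.
have lt_mN : (2 * m < N)%N by rewrite /N /M; lia.
have /dvdXnP/(_ _ lt_mN) := trunc_pow N central_gf j.
by rewrite coefB coef_poly lt_mN => ->.
Qed.

Theorem lemma2p1 (m : nat) :
  RE m = 2%:R * (2%:R ^+ (2 * m + 2) - 1) * bernoulli (2 * m + 2) / (m + 1)%:R.
Proof.
rewrite -[RE m](divfK (factr_neq0 (2 * m))) RE_coef /h_coef addn2 addn1.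
(* In (2m + 2)! = 2 (m + 1) (2m + 1) (2m)! the last two factors cancel, and 4 / (2 (m + 1)) is the
   required 2 / (m + 1). *)
rewrite !factS !natrM (_ : ((2 * m).+2)%:R = 2%:R * (m.+1)%:R); last first.
  by rewrite -natrM mulnS.
by field; rewrite factr_neq0 -natrM !(addrC 1) !natr1 !pnatr_eq0.
Qed.
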